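(* Let $A$ be a finite non-empty alphabet. Every Lyndon infinite word $s\in A^\omega$ begins with infinitely many unbordered prefixes, and hence belongs to $\mathcal P_2$.
   Context: $A^\omega$ is the set of one-sided infinite words over $A$. An infinite word $s\in A^\omega$ is Lyndon if there exists a linear order on $A$ with respect to which $s$ is lexicographically (strictly) smaller than all its proper suffixes. A non-empty finite word $v$ is a border of a finite word $u$ if $v$ is both a proper prefix and a proper suffix of $u$; a non-empty finite word is unbordered if it has no border. $\mathrm{Fact}^+s$ is the set of non-empty finite factors (contiguous blocks) of $s$. A factorization of $s$ is an expression $s=U_1U_2U_3\cdots$ with all $U_i$ non-empty finite words. For $k\ge 2$, $\mathcal P_k$ is the class of infinite words $s$ over finite alphabets for which there is a map (coloring) $c:\mathrm{Fact}^+s\to C$ with $\mathrm{card}(C)=k$ such that for each factorization $s=U_1U_2U_3\cdots$ there exist $i,j\ge1$ with $c(U_i)\ne c(U_j)$. *)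

(* Defs.v *)
From mathcomp Require Import all_boot.
From mathcomp Require Import boolp classical_sets.

Set Implicit Arguments.
Unset Strict Implicit.
Unset Printing Implicit Defensive.

Local Open Scope classical_set_scope.

(* A one-sided infinite word s_0 s_1 s_2 ... *)
Definition infword (A : Type) := nat -> A.

(* The block s_i s_(i+1) ... s_(i+n-1). *)
Definition block (A : Type) (s : infword A) (i n : nat) : seq A :=
  mkseq (fun j => s (i + j)) n.

Definition wprefix (A : Type) (s : infword A) (n : nat) : seq A := block s 0 n.

Definition wsuffix (A : Type) (s : infword A) (n : nat) : infword A :=
  fun j => s (n + j).

(* Fact^+ s.  As a type, its elements carry a boolean membership proof, so a
   function on it depends on the underlying finite word only. *)
Definition Fact (A : Type) (s : infword A) : set (seq A) :=
  [set u | u <> [::] /\ exists i n, u = block s i n].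

Definition linear_order (A : eqType) (le : rel A) : Prop :=
  [/\ reflexive le, antisymmetric le, transitive le & total le].

Definition lex_lt (A : eqType) (le : rel A) (s t : infword A) : Prop :=
  exists k, (forall i, i < k -> s i = t i) /\ (le (s k) (t k) && (s k != t k)).

(* Proper suffixes are those starting at a position n > 0, even when such a
   suffix is equal to s as a word: a purely periodic word is not Lyndon. *)
Definition Lyndon (A : eqType) (s : infword A) : Prop :=
  exists le : rel A, linear_order le /\
    forall n, 0 < n -> lex_lt le s (wsuffix s n).

Definition border (A : eqType) (v u : seq A) : Prop :=
  [/\ v <> [::], prefix v u, suffix v u & v <> u].

Definition unbordered (A : eqType) (u : seq A) : Prop :=
  u <> [::] /\ forall v, ~ border v u.

(* s = U_0 U_1 U_2 ... : every finite concatenation U_0 ... U_(n-1) is a prefix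
   of s; the blocks being non-empty, this determines s entirely. *)
Definition factorization (A : Type) (s : infword A) (U : nat -> seq A) : Prop :=
  (forall i, U i <> [::]) /\
  forall n, flatten (mkseq U n) = wprefix s (size (flatten (mkseq U n))).

(* The blocks of a factorization are automatically in Fact s, so nothing is
   lost in [Pclass] by letting factorizations range over nat -> Fact s. *)
Lemma factorization_Fact (A : Type) (s : infword A) (U : nat -> seq A) :
  factorization s U -> forall i, Fact s (U i).
Proof.
move=> [U0 Us] i; split; first exact: U0.
set m := size (flatten (mkseq U i)); exists m, (size (U i)).
have := Us i.+1; rewrite mkseqS flatten_rcons size_cat -/m => E.
have {E} := congr1 (drop m) E; rewrite drop_size_cat // => E.
rewrite [LHS]E /wprefix /block /mkseq -map_drop drop_iota addKn add0n.
by rewrite -[X in iota X]addn0 iotaDl -map_comp; apply: eq_map.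
Qed.

(* The class P_k (for k >= 2) of infinite words over the finite alphabet A. *)
Definition Pclass (k : nat) (A : finType) (s : infword A) : Prop :=
  exists (C : finType) (c : Fact s -> C), #|C| = k /\
    forall U : nat -> Fact s, factorization s (fun i => \val (U i)) ->
      exists i j, c (U i) <> c (U j).

(* Main.v *)
(** For [p > 0] let [e p] be the length of the shortest prefix of [s] that
    witnesses that [s] is smaller than its suffix at [p].  A prefix of length
    [L] is unbordered iff [e p <= L] for all [0 < p < L].  If [p < q < e p]
    then [e q <= e p], since otherwise the suffix at [q - p] would be smaller
    than [s]; so enlarging an unbordered length [p] to [e p] again gives an
    unbordered length.

    For the second claim, color a factor according to whether it is a prefix of
    [s].  The first block of a factorization is a prefix; if all were, then any
    unbordered prefix longer than the first block would end inside a later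
    block, and so would have a border. *)

Require Import Defs.
From mathcomp Require Import all_boot.
From mathcomp Require Import boolp classical_sets.
From mathcomp Require Import zify.

Section Words.
Set Implicit Arguments.
Unset Strict Implicit.
Variables (A : eqType) (s : infword A).

Lemma size_block i n : size (block s i n) = n.
Proof. exact: size_mkseq. Qed.

Lemma nth_block x0 i n j : j < n -> nth x0 (block s i n) j = s (i + j).
Proof. by move=> jn; rewrite nth_mkseq. Qed.

Lemma block_eqP i j n :
  block s i n = block s j n <-> forall k, k < n -> s (i + k) = s (j + k).
Proof.
split=> [E k kn|E]; first by rewrite -!(nth_block (s 0) _ kn) E.
apply: (@eq_from_nth _ (s 0)); rewrite !size_block // => k kn.
by rewrite !nth_block // E.
Qed.

Lemma take_block i m n : m <= n -> take m (block s i n) = block s i m.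
Proof. by move=> mn; rewrite /block /mkseq -map_take take_iota (minn_idPl mn). Qed.

Lemma drop_block i m n : drop m (block s i n) = block s (i + m) (n - m).
Proof.
apply: (@eq_from_nth _ (s 0)); rewrite size_drop !size_block // => k kn.
by rewrite nth_drop !nth_block ?addnA //; lia.
Qed.

(** Borders are indexed by the position [p] where the suffix copy starts, i.e. by the periods of the
    prefix. *)
Lemma border_wprefix L v :
  border v (wprefix s L) <->
  exists2 p, 0 < p < L & v = wprefix s (L - p) /\ v = block s p (L - p).
Proof.
split.
  move=> [v0 /[dup] /size_prefix]; rewrite size_block => vL.
  rewrite prefixE suffixE size_block take_block // drop_block add0n.
  move=> /eqP pv /eqP sv vu; exists (L - size v).
    case: v v0 vL pv sv vu => // a v _ vL pv sv vu.
    suff : size (a :: v) != L by rewrite /= in vL *; lia.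
    by apply/eqP => vE; apply: vu; rewrite -pv vE.
  by rewrite subKn //; split; [rewrite -[LHS]pv | rewrite -[LHS]sv subKn].
move=> [p /andP[p0 pL] [vp vs]]; have size_v : size v = L - p.
  by rewrite vp size_block.
split.
- by move=> v0; rewrite v0 /= in size_v; lia.
- by rewrite prefixE size_v take_block ?leq_subr // vp.
- by rewrite suffixE size_v size_block subKn ?(ltnW pL) // drop_block add0n vs.
- by move/(congr1 size); rewrite size_v size_block; lia.
Qed.

Definition lt_suffix_at (le : rel A) p k :=
  (forall i, i < k -> s i = s (p + i)) /\ (le (s k) (s (p + k)) && (s k != s (p + k))).

(** This is [e p <= L] for all [0 < p < L], where [e p = p + k + 1] for the first mismatch [k]. *)
Definition separated (le : rel A) L :=
  forall p, 0 < p < L -> exists2 k, p + k < L & lt_suffix_at le p k.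

Lemma separated_unbordered le L : 0 < L -> separated le L -> unbordered (wprefix s L).
Proof.
move=> L0 sepL; split; first by move/(congr1 size); rewrite size_block /=; lia.
move=> v /border_wprefix [p /sepL [k kL [_ /andP[_ /eqP neq]]] [-> /block_eqP E]].
by apply: neq; rewrite -(E k) //; lia.
Qed.

Lemma separated_extend le L k : linear_order le ->
    (forall n, 0 < n -> lex_lt le s (wsuffix s n)) ->
  separated le L -> lt_suffix_at le L k -> separated le (L + k).+1.
Proof.
move=> [_ anti _ _] lyn sepL [eqL ltL] q /andP[q0 qk].
(* Shifts below [L] are settled by [sepL], the shift [L] by [k]; the work is for [q > L]. *)
have [qL|Lq|->] := ltngtP q L; last by exists k.
  have [|j jL ltj] := sepL q; first by rewrite q0.
  by exists j => //; lia.
have [k' [eqq ltq]] := lyn q q0; exists k' => //; rewrite ltnNge; apply/negP => k'L.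
have r0 : 0 < q - L by lia.
have [k'' [eqr /andP[ler /eqP neqr]]] := lyn _ r0.
rewrite /wsuffix in eqq eqr ler neqr.
(* Seen from [q], the mismatch position [L + k] has offset [j < k'], so [s j = s (L + k)], while
   [s (q - L + j) = s k] is smaller. Hence the suffix at [q - L] first differs from [s] at [j], and
   is smaller there. *)
pose j := L + k - q.
have qE i : L + (q - L + i) = q + i by lia.
have rj : q - L + j = k by lia.
have eqj i : i < j -> s (q - L + i) = s i.
  by move=> ij; rewrite eqL ?qE -?eqq //; lia.
have /andP[lej /eqP neqj] : le (s (q - L + j)) (s j) && (s (q - L + j) != s j).
  by rewrite (eqq j) -?qE ?rj //; lia.
have [k''j|jk''|k''j] := ltngtP k'' j.
- by apply: neqr; rewrite eqj.
- by apply: neqj; rewrite -eqr.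
- by apply: neqr; apply: anti; rewrite ler k''j lej.
Qed.

Lemma Lyndon_unbordered_prefixes : Lyndon s ->
  forall N, exists n, N <= n /\ unbordered (wprefix s n).
Proof.
move=> [le [lin lyn]] N.
suff [L NL sepL] : exists2 L, N < L & separated le L.
  by exists L; split; [exact: ltnW | apply: (separated_unbordered _ sepL); lia].
(* Length 1 is separated vacuously. *)
elim: N => [|N [L NL sepL]]; first by exists 1 => // p; lia.
have [k ltk] := lyn L (leq_ltn_trans (leq0n N) NL).
by exists (L + k).+1; [lia | exact: separated_extend].
Qed.

Lemma factorization_block U n : factorization s U ->
  U n = block s (size (flatten (mkseq U n))) (size (U n)).
Proof.
move=> [_ Us]; have := congr1 (drop (size (flatten (mkseq U n)))) (Us n.+1).
rewrite drop_block mkseqS flatten_rcons drop_size_cat // size_cat addKn add0n.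
exact.
Qed.

Lemma factorization_prefixes_bordered U L : factorization s U ->
    (forall i, prefix (U i) (wprefix s (size (U i)))) -> size (U 0) < L ->
  ~ unbordered (wprefix s L).
Proof.
move=> facU preU UL [_]; pose P n := size (flatten (mkseq U n)).
have PS n : P n.+1 = P n + size (U n).
  by rewrite /P mkseqS flatten_rcons size_cat.
have Pge n : n <= P n.
  elim: n => // n IHn; rewrite PS.
  have : size (U n) != 0 by apply/eqP => /size0nil; exact: facU.1.
  by lia.
have exL : exists n, L <= P n by exists L.
(* The least [n] with [L <= P n] is at least 2 because [P 1 = size (U 0) < L]; so [L] falls in a
   block starting at a positive position. *)
case: (ex_minnP exL) => -[|[|n]] LP minP.
- by move: LP; rewrite /P /=; lia.
- by move: LP; rewrite PS /P /=; lia.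
have PL : P n.+1 < L by rewrite ltnNge; apply/negP => /minP; rewrite ltnn.
have P0 := Pge n.+1; have := PS n.+1; set m := size (U n.+1) => Pm.
(* The border is the part of [U n.+1] before position [L]: it begins a block that is itself a prefix
   of [s]. *)
apply; apply/border_wprefix; exists (P n.+1); first by lia.
split; [reflexivity|].
have Lm : L - P n.+1 <= m by lia.
rewrite /wprefix -(take_block 0 Lm) -(take_block (P n.+1) Lm).
by rewrite -(factorization_block n.+1 facU); congr take; have := preU n.+1;
  rewrite prefixE take_block // => /eqP.
Qed.

End Words.

Lemma unbordered_prefixes_Pclass2 (A : finType) (s : infword A) :
  (forall N, exists n, N <= n /\ unbordered (wprefix s n)) -> Pclass 2 s.
Proof.
move=> unb; exists bool, (fun u => prefix (\val u) (wprefix s (size (\val u)))).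
split=> [|U facU]; first exact: card_bool.
apply: contrapT => mono.
have [L [UL]] := unb (size (\val (U 0))).+1.
apply: (factorization_prefixes_bordered facU) UL => i.
(* The common color is that of [U 0], which is [true]. *)
suff <- : prefix (\val (U 0)) (wprefix s (size (\val (U 0)))) =
          prefix (\val (U i)) (wprefix s (size (\val (U i)))).
  by rewrite {1}(factorization_block 0 facU) prefix_refl.
by apply: contrapT => neq; apply: mono; exists 0, i.
Qed.

Theorem mainTheorem9 (A : finType) (hA : 0 < #|A|) (s : infword A)
    (hs : Lyndon s) :
  (forall N : nat, exists n : nat, N <= n /\ unbordered (wprefix s n)) /\
  Pclass 2 s.
Proof.
have unb := Lyndon_unbordered_prefixes hs.
by split=> //; exact: unbordered_prefixes_Pclass2.
Qed.
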